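(* For every integer $N \geq 2$, the number of linear doilies in $\mathcal{W}(2N-1,2)$ is $$D_l(N) = \binom{2N}{4}_2 - \binom{N}{4}_2 \prod_{i=1}^{4}\left(2^{N+1-i}+1\right) - \frac{7}{3}\, 2^{2N-6} \binom{N}{3}_2 \prod_{i=1}^{3}\left(2^{N+1-i}+1\right).$$
   Context: Gaussian coefficient: $\binom{n}{k}_q = \prod_{i=1}^{k}\frac{q^{n-k+i}-1}{q^i-1}$ (the number of $k$-dimensional vector subspaces of $\mathbb{F}_q^n$; it is $0$ when $k>n$). $\mathrm{PG}(d,2)$ is the projective space of $\mathbb{F}_2^{d+1}$; its points are the nonzero vectors and its lines the triples $\{a,b,a+b\}$. $\mathcal{W}(2N-1,2)$ is the symplectic polar space whose points are all points of $\mathrm{PG}(2N-1,2)$ (nonzero vectors of $\mathbb{F}_2^{2N}$) and whose subspaces are those totally isotropic for the symplectic form $\sigma(x,y)=\sum_{j=1}^N (x_j y_{N+j}+x_{N+j}y_j)$. Its lines are the triples $\{a,b,a+b\}$ with $a\neq b$ nonzero and $\sigma(a,b)=0$. The doily is the unique generalized quadrangle $\mathrm{GQ}(2,2)$ (15 points, 15 lines, 3 points per line, 3 lines per point, and for each point $p$ not on a line $L$ there is a unique point of $L$ collinear with $p$). A doily in $\mathcal{W}(2N-1,2)$ (an $N$-qubit doily) is a set of 15 points of $\mathcal{W}(2N-1,2)$ together with 15 lines of $\mathcal{W}(2N-1,2)$ on these points, forming an incidence structure isomorphic to the doily, such that two distinct points $a,b$ of it satisfy $\sigma(a,b)=0$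 if and only if they lie on a common line of it. A doily in $\mathcal{W}(2N-1,2)$ is called linear if its 15 points span a $\mathrm{PG}(3,2)$ (i.e. a 4-dimensional vector subspace of $\mathbb{F}_2^{2N}$). *)

(* Defs.v *)
From mathcomp Require Import all_boot all_order all_algebra.
Set Implicit Arguments.
Unset Strict Implicit.
Unset Printing Implicit Defensive.
Import GRing.Theory.
Local Open Scope ring_scope.

(* The exponent is an integer, so that the formula makes sense verbatim for
   n < k; the factor of index i = k - n then vanishes and the value is 0. *)
Definition gauss_binom (q : rat) (n k : nat) : rat :=
  \prod_(1 <= i < k.+1) ((q ^ (n%:Z - k%:Z + i%:Z) - 1) / (q ^+ i - 1)).

(* Coordinates j and N + j of a vector are lshift N j and rshift N j. *)
Definition symp_space (N : nat) := 'rV['F_2]_(N + N).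

Definition sigma (N : nat) (x y : symp_space N) : 'F_2 :=
  \sum_(j < N) (x 0 (lshift N j) * y 0 (rshift N j)
                + x 0 (rshift N j) * y 0 (lshift N j)).

Definition W_points (N : nat) : {set symp_space N} := [set a | a != 0].

Definition W_lines (N : nat) : {set {set symp_space N}} :=
  [set [set ab.1; ab.2; ab.1 + ab.2] |
    ab in [set ab : symp_space N * symp_space N |
            [&& ab.1 \in W_points N, ab.2 \in W_points N,
                ab.1 != ab.2 & sigma ab.1 ab.2 == 0]]].

Definition collinear (T : finType) (L : {set {set T}}) (a b : T) : bool :=
  [exists l in L, (a \in l) && (b \in l)].

(* Point-line geometries are given by a set P of points and a set L of lines,
   each line being the set of its points.  The doily is the generalized
   quadrangle GQ(2,2), which is unique up to isomorphism; being isomorphic to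
   it therefore means being a GQ(2,2). *)
Definition is_GQ22 (T : finType) (P : {set T}) (L : {set {set T}}) : bool :=
  [&& #|P| == 15%N,
      #|L| == 15%N,
      [forall l in L, (l \subset P) && (#|l| == 3%N)],
      [forall a in P, #|[set l in L | a \in l]| == 3%N],
      [forall l1 in L, forall l2 in L,
        (l1 != l2) ==> (#|l1 :&: l2| <= 1)%N]
    & [forall a in P, forall l in L,
        (a \notin l) ==> (#|[set b in l | collinear L a b]| == 1%N)]].

Definition is_doily (N : nat) (P : {set symp_space N})
    (L : {set {set symp_space N}}) : bool :=
  [&& P \subset W_points N,
      L \subset W_lines N,
      is_GQ22 P L
    & [forall a in P, forall b in P,
        (a != b) ==> ((sigma a b == 0) == collinear L a b)]].

Definition is_linear (N : nat) (P : {set symp_space N}) : bool :=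
  \dim <<enum P>>%VS == 4%N.

Definition linear_doilies (N : nat) :
    {set {set symp_space N} * {set {set symp_space N}}} :=
  [set D | is_doily D.1 D.2 && is_linear D.1].

(* Main.v *)
(* The point set of a linear doily is V \ {0} for a 4-dimensional subspace V
   on which sigma is nondegenerate, its lines are all the totally isotropic
   lines of V, and conversely every such V carries a doily.  The subspaces V
   are counted through their symplectic bases (e, f, e', f'): a nondegenerate
   space with 8k vectors has (8k-1)(4k)(2k-1)k of them, which is 720 for V,
   and each symplectic quadruple of the whole space is a basis of exactly one
   V.  Hence the number of linear doilies is (4^N-1) 2^(2N-1) (4^(N-1)-1)
   2^(2N-3) / 720, which agrees with the stated formula as a polynomial in
   2^N. *)
Require Import Defs.
From mathcomp Require Import all_boot all_order all_algebra.
From mathcomp Require Import finfield zify ring.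
Set Implicit Arguments.
Unset Strict Implicit.
Unset Printing Implicit Defensive.
Import GRing.Theory.
Local Open Scope ring_scope.

(** * The field with two elements *)

Lemma F2_neq0 (x : 'F_2) : x != 0 -> x = 1.
Proof. by case: x => [[|[|//]] Hx] // _; apply/val_inj. Qed.

Lemma addF2 (x : 'F_2) : x + x = 0.
Proof. by case: x => [[|[|//]] Hx]; apply/val_inj. Qed.

Lemma F2_add_eq0 (x y : 'F_2) : (x + y == 0) = ((x == 0) == (y == 0)).
Proof.
have [-> | /F2_neq0->] := eqVneq x 0; first by rewrite add0r.
by have [-> | /F2_neq0->] := eqVneq y 0.
Qed.

(** * Vectors over the two-element field and the symplectic form *)

Section Symplectic.
Variable N : nat.
Implicit Types (a b c e f x y z : symp_space N) (A P : {set symp_space N}).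

Lemma addvv x : x + x = 0.
Proof. by apply/rowP=> i; rewrite !mxE addF2. Qed.

Lemma oppv x : - x = x.
Proof. by apply/eqP; rewrite eq_sym -addr_eq0 addvv. Qed.

Lemma addvK x : involutive (+%R^~ x).
Proof. by move=> y; rewrite -addrA addvv addr0. Qed.

Lemma addv_eq0 x y : (x + y == 0) = (x == y).
Proof. by rewrite addr_eq0 oppv. Qed.

Lemma sigmaDl x y z : sigma (x + y) z = sigma x z + sigma y z.
Proof.
by rewrite /sigma -big_split; apply: eq_bigr => j _ /=; rewrite !mxE; ring.
Qed.

Lemma sigmaC x y : sigma x y = sigma y x.
Proof.
by apply: eq_bigr => j _; rewrite addrC [x _ _ * _]mulrC [x _ _ * _]mulrC.
Qed.

Lemma sigmaDr x y z : sigma x (y + z) = sigma x y + sigma x z.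
Proof. by rewrite sigmaC sigmaDl !(sigmaC x). Qed.

Lemma sigmaZl k x y : sigma (k *: x) y = k * sigma x y.
Proof.
by rewrite /sigma mulr_sumr; apply: eq_bigr => j _; rewrite !mxE; ring.
Qed.

Lemma sigmaZr k x y : sigma x (k *: y) = k * sigma x y.
Proof. by rewrite sigmaC sigmaZl sigmaC. Qed.

Lemma sigmavv x : sigma x x = 0.
Proof.
by apply: big1 => j _; rewrite [X in _ + X]mulrC addF2.
Qed.

Lemma sigma0v x : sigma 0 x = 0.
Proof. by rewrite -(addvv 0) sigmaDl addF2. Qed.

Lemma sigmav0 x : sigma x 0 = 0.
Proof. by rewrite sigmaC sigma0v. Qed.

(** Pairing [x] with the unit vector at the partner of a coordinate isolates that coordinate, so a
    nonzero coordinate of [x] gives the witness. *)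
Lemma sigma_nondeg x : x != 0 -> exists y, sigma x y != 0.
Proof.
move=> x0; have [i xi] : exists i, x 0 i != 0.
  apply/existsP; apply: contraR x0; rewrite negb_exists => /forallP h.
  by apply/eqP/rowP=> i; rewrite mxE; apply/eqP; rewrite -[_ == _]negbK h.
have deltaE j (k : 'I_(N + N)) :
  (delta_mx 0 j : symp_space N) 0 k = (k == j)%:R by rewrite mxE.
rewrite /sigma; case: (split_ordP i) xi => j -> xj.
- exists (delta_mx 0 (rshift N j)); rewrite (bigD1 j) //= big1 => [|k kj].
    by rewrite !deltaE eqxx (eq_lrshift j j) mulr0 mulr1 !addr0.
  rewrite !deltaE (eq_lrshift k j) (inj_eq (@rshift_inj _ _)) (negPf kj).
  by rewrite !mulr0 addr0.
- exists (delta_mx 0 (lshift N j)); rewrite (bigD1 j) //= big1 => [|k kj].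
    by rewrite !deltaE eqxx (eq_rlshift j j) mulr0 mulr1 !addr0 add0r.
  rewrite !deltaE (eq_rlshift k j) (inj_eq (@lshift_inj _ _)) (negPf kj).
  by rewrite !mulr0 addr0.
Qed.

(** * Nondegenerate subspaces *)

(* Over F_2 a subspace is just a set containing 0 and closed under addition. *)
Definition symp_sub A :=
  [&& 0 \in A, [forall x in A, forall y in A, x + y \in A] &
   [forall x in A, (x != 0) ==> [exists y in A, sigma x y != 0]]].

Lemma symp_subP A :
  reflect [/\ 0 \in A, {in A &, forall x y, x + y \in A} &
     {in A, forall x, x != 0 -> exists2 y, y \in A & sigma x y != 0}]
    (symp_sub A).
Proof.
apply: (iffP and3P) => -[A0 AD Anz]; split=> //.
- by move=> x y xA yA; move/forall_inP: AD => /(_ _ xA)/forall_inP/(_ _ yA).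
- move=> x xA x0; move/forall_inP: Anz => /(_ _ xA)/implyP/(_ x0).
  by case/exists_inP=> y; exists y.
- by apply/forall_inP=> x xA; apply/forall_inP=> y yA; apply: AD.
- apply/forall_inP=> x xA; apply/implyP=> x0; apply/exists_inP.
  by case: (Anz _ xA x0) => y; exists y.
Qed.

Lemma symp_subZ A k x : symp_sub A -> x \in A -> k *: x \in A.
Proof.
case/symp_subP=> A0 _ _ xA.
by have [-> | /F2_neq0->] := eqVneq k 0; rewrite ?scale0r ?scale1r.
Qed.

Lemma symp_sub_setT : symp_sub setT.
Proof.
apply/symp_subP; split=> [|x y _ _|x _ /sigma_nondeg[y xy]]; rewrite ?inE //.
by exists y; rewrite ?inE.
Qed.

(** * Orthogonals inside a subspace and hyperbolic pairs *)

Definition perp A c := [set x in A | sigma c x == 0].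

Lemma perpP A c x : reflect (x \in A /\ sigma c x = 0) (x \in perp A c).
Proof. by rewrite inE; apply: (iffP andP) => -[xA /eqP]. Qed.

Lemma perp_closed A c : {in A &, forall x y, x + y \in A} ->
  {in perp A c &, forall x y, x + y \in perp A c}.
Proof.
move=> AD x y /perpP[xA cx] /perpP[yA cy]; apply/perpP.
by rewrite AD // sigmaDr cx cy addr0.
Qed.

(** Translation by [g] flips the value of [sigma c], so it exchanges the orthogonal of [c] with its
    complement in [A]. *)
Lemma card_nonperp A c g : {in A &, forall x y, x + y \in A} ->
  g \in A -> sigma c g != 0 -> #|A :\: perp A c| = #|perp A c|.
Proof.
move=> AD gA cg; rewrite -(card_imset (perp A c) (inv_inj (addvK g))).
apply: eq_card => x; apply/idP/imsetP => [|[y /perpP[yA cy] ->]].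
- rewrite !inE => /andP[+ xA]; rewrite xA /= => cx.
  exists (x + g); last by rewrite addvK.
  by apply/perpP; rewrite AD // sigmaDr (F2_neq0 cg) (F2_neq0 cx) addF2.
- by rewrite !inE AD // sigmaDr cy add0r cg.
Qed.

Lemma card_perp A c g : {in A &, forall x y, x + y \in A} ->
  g \in A -> sigma c g != 0 -> #|A| = #|perp A c|.*2.
Proof.
move=> AD gA cg; have /setIidPr AI : perp A c \subset A by apply/subsetP=> x /perpP[].
by rewrite -(cardsID (perp A c) A) AI (card_nonperp AD gA cg) addnn.
Qed.

Definition hyp_pairs A :=
  [set t : symp_space N * symp_space N |
     [&& t.1 \in A, t.2 \in A & sigma t.1 t.2 != 0]].

(** Each of the [2 * k - 1] nonzero vectors of [A] is non-orthogonal to exactly half of [A]. *)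
Lemma card_hyp_pairs A k : symp_sub A -> #|A| = (2 * k)%N ->
  #|hyp_pairs A| = ((2 * k - 1) * k)%N.
Proof.
case/symp_subP=> A0 AD And cA.
have -> : #|hyp_pairs A| = (\sum_(x in A | x != 0%R) #|A :\: perp A x|)%N.
  rewrite -sum1_card (eq_bigl (fun t => ((t.1 \in A) && (t.1 != 0)) &&
    (t.2 \in A :\: perp A t.1))).
    rewrite -(pair_big_dep (fun x => (x \in A) && (x != 0))
      (fun x y => y \in A :\: perp A x) (fun _ _ => 1%N)) /=.
    by apply: eq_bigr => x _; rewrite sum1_card.
  (* The condition [x != 0] comes for free, since 0 is orthogonal to everything. *)
  case=> x y; rewrite !inE /=; case: (x \in A) => //=.
  by have [-> | _] := eqVneq x 0; case: (y \in A); rewrite /= ?sigma0v ?eqxx ?andbT.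
rewrite (eq_bigr (fun=> k)) => [|x /andP[xA x0]].
  rewrite sum_nat_const; congr muln; rewrite -cA (cardsD1 0 A) A0 add1n subn1.
  by apply: eq_card => x; rewrite !inE andbC.
have [g gA xg] := And _ xA x0.
rewrite (card_nonperp AD gA xg); have := card_perp AD gA xg; lia.
Qed.

(** Splitting off a hyperbolic plane: its orthogonal complement in [A] stays nondegenerate, and each
    of the two orthogonality conditions halves the cardinality. *)
Lemma perp2_symp_sub A e f : symp_sub A -> (e, f) \in hyp_pairs A ->
  symp_sub (perp (perp A e) f) /\ #|A| = (4 * #|perp (perp A e) f|)%N.
Proof.
move=> sA; have /symp_subP[A0 AD And] := sA.
rewrite inE /= => /and3P[eA fA ef].
have ef1 := F2_neq0 ef.
split; last first.
  rewrite (card_perp AD fA ef) (@card_perp (perp A e) f e) ?[sigma f e]sigmaC //.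
  - by rewrite -!mul2n mulnA.
  - exact: perp_closed.
  - by apply/perpP; rewrite sigmavv.
apply/symp_subP; split.
- by apply/perpP; rewrite sigmav0; split=> //; apply/perpP; rewrite sigmav0.
- by do 2!apply: perp_closed.
move=> x /perpP[/perpP[xA ex] fx] x0; have [y yA xy] := And _ xA x0.
(* Subtract from [y] its projection to the plane of [e] and [f]; as [x] is orthogonal to both, its
   pairing with [y] does not change. *)
exists (y + (sigma f y *: e + sigma e y *: f)).
  apply/perpP; split; first apply/perpP; first split.
  - by rewrite !AD ?symp_subZ.
  - by rewrite !sigmaDr !sigmaZr sigmavv ef1 mulr0 add0r mulr1 addF2.
  - rewrite !sigmaDr !sigmaZr sigmavv [sigma f e]sigmaC ef1.
    by rewrite mulr0 addr0 mulr1 addF2.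
by rewrite !sigmaDr !sigmaZr !(sigmaC x) ex fx !mulr0 !addr0 sigmaC.
Qed.

(** * Symplectic quadruples and the subspaces they span *)

Local Notation quad :=
  ((symp_space N * symp_space N) * (symp_space N * symp_space N))%type.

Definition hyp_quads A :=
  [set t : quad | (t.1 \in hyp_pairs A) &&
     (t.2 \in hyp_pairs (perp (perp A t.1.1) t.1.2))].

(** Choose a first pair in [A], then a second one in the orthogonal complement of the first, which
    has [2 * k] elements. *)
Lemma card_hyp_quads A k : symp_sub A -> #|A| = (8 * k)%N ->
  #|hyp_quads A| = ((8 * k - 1) * (4 * k) * ((2 * k - 1) * k))%N.
Proof.
move=> sA cA.
have -> : #|hyp_quads A| =
    (\sum_(t in hyp_pairs A) #|hyp_pairs (perp (perp A t.1) t.2)|)%N.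
  rewrite -sum1_card (eq_bigl (fun t => (t.1 \in hyp_pairs A) &&
    (t.2 \in hyp_pairs (perp (perp A t.1.1) t.1.2)))).
    rewrite -(pair_big_dep (fun t => t \in hyp_pairs A)
      (fun t u => u \in hyp_pairs (perp (perp A t.1) t.2)) (fun _ _ => 1%N)) /=.
    by apply: eq_bigr => x _; rewrite sum1_card.
  by move=> t; rewrite inE.
rewrite (eq_bigr (fun=> ((2 * k - 1) * k)%N)) => [|[e f] tA].
  rewrite sum_nat_const (@card_hyp_pairs _ (4 * k)) //; last lia.
  by congr muln; congr muln; lia.
have [sB cB] := perp2_symp_sub sA tA; apply: card_hyp_pairs => //=.
by apply/eqP; rewrite -(eqn_pmul2l (isT : 0 < 4)%N) -cB cA mulnA.
Qed.

(* On the nondegenerate span of a symplectic quadruple t, hyp_proj t is the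
   orthogonal projection, so that the span is its set of fixed points. *)
Definition hyp_proj (t : quad) x :=
  (sigma t.1.2 x *: t.1.1 + sigma t.1.1 x *: t.1.2)
  + (sigma t.2.2 x *: t.2.1 + sigma t.2.1 x *: t.2.2).

Definition hyp_span t := [set x | hyp_proj t x == x].

Lemma hyp_projD t x y : hyp_proj t (x + y) = hyp_proj t x + hyp_proj t y.
Proof.
rewrite /hyp_proj !sigmaDr !scalerDl [RHS]addrACA.
by rewrite [X in _ = X + _]addrACA [X in _ = _ + X]addrACA.
Qed.

Lemma hyp_quadsP A e f e' f' :
  reflect [/\ [/\ e \in A, f \in A, e' \in A & f' \in A],
     sigma e f = 1 /\ sigma e' f' = 1 &
     [/\ sigma e e' = 0, sigma e f' = 0, sigma f e' = 0 & sigma f f' = 0]]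
   (((e, f), (e', f')) \in hyp_quads A).
Proof.
rewrite !inE /=; apply: (iffP idP).
  case/andP=> /and3P[-> -> /F2_neq0->].
  by case/and3P=> /andP[/andP[-> /eqP->] /eqP->] /andP[/andP[-> /eqP->] /eqP->] /F2_neq0->.
by case=> -[-> -> -> ->] [-> ->] [-> -> -> ->].
Qed.

(** The difference between [x] in [A] and its projection is orthogonal to the whole quadruple. The
    vectors of [A] with this property number 16 / (4 * 4) = 1, so the difference is 0. *)
Lemma hyp_span_uniq A t : symp_sub A -> #|A| = 16%N -> t \in hyp_quads A ->
  A = hyp_span t.
Proof.
move: t => [[e f] [e' f']] sA cA tA.
have /hyp_quadsP[[eA fA e'A f'A] [ef ef'] [ee' ef'0 fe' ff']] := tA.
have /symp_subP[_ AD _] := sA.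
have pA x : hyp_proj ((e, f), (e', f')) x \in A by rewrite !AD ?symp_subZ.
apply/setP=> x; rewrite [RHS]inE; apply/idP/eqP => [xA | <- //].
move: tA; rewrite inE /= => /andP[tA uA].
have [sB cB] := perp2_symp_sub sA tA; have [sC cC] := perp2_symp_sub sB uA.
set C := perp (perp _ _) _ in sC cC; have /symp_subP[C0 _ _] := sC.
suff: x + hyp_proj ((e, f), (e', f')) x \in C.
  have /cards1P[z Cz] : #|C| == 1%N.
    by rewrite -(eqn_pmul2l (isT : 0 < 4 * 4)%N) -mulnA -cC -cB cA.
  by move: C0; rewrite Cz !inE => /eqP<-; rewrite addv_eq0 eq_sym => /eqP.
have fe1 : sigma f e = 1 by rewrite sigmaC.
have f'e'1 : sigma f' e' = 1 by rewrite sigmaC.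
have e'e : sigma e' e = 0 by rewrite sigmaC.
have f'e : sigma f' e = 0 by rewrite sigmaC.
have e'f : sigma e' f = 0 by rewrite sigmaC.
have f'f : sigma f' f = 0 by rewrite sigmaC.
have sE := (ef, ef', ee', ef'0, fe', ff', fe1, f'e'1, e'e, f'e, e'f, f'f, sigmavv).
(* When [c] is one of the four basis vectors, a single term of the projection survives and it equals
   [sigma c x], so the total vanishes. *)
have calc c : sigma c (x + hyp_proj ((e, f), (e', f')) x) = sigma c x +
   (sigma f x * sigma c e + sigma e x * sigma c f +
    (sigma f' x * sigma c e' + sigma e' x * sigma c f')).
  by rewrite /hyp_proj /= !sigmaDr !sigmaZr.
have xpA := AD _ _ xA (pA x).
by do 4?[apply/perpP; split];
  rewrite ?calc ?sE ?(mulr0, mulr1, addr0, add0r) ?addF2.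
Qed.

(** A fixed point of [hyp_proj t] is a combination of the quadruple with coefficients its pairings
    with the quadruple; if these all vanish, it is 0. This gives both nondegeneracy and, by
    splitting off two planes, the cardinality 4 * 4 * 1. *)
Lemma hyp_span_symp_sub t : t \in hyp_quads setT ->
  [/\ symp_sub (hyp_span t), #|hyp_span t| = 16%N & t \in hyp_quads (hyp_span t)].
Proof.
move: t => [[e f] [e' f']] /hyp_quadsP[_ [ef ef'] [ee' ef'0 fe' ff']].
have fe1 : sigma f e = 1 by rewrite sigmaC.
have f'e'1 : sigma f' e' = 1 by rewrite sigmaC.
have e'e : sigma e' e = 0 by rewrite sigmaC.
have f'e : sigma f' e = 0 by rewrite sigmaC.
have e'f : sigma e' f = 0 by rewrite sigmaC.
have f'f : sigma f' f = 0 by rewrite sigmaC.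
have sE := (ef, ef', ee', ef'0, fe', ff', fe1, f'e'1, e'e, f'e, e'f, f'f, sigmavv).
have zE := (scale0r, scale1r, addr0, add0r).
set t := (_, _); have tA : t \in hyp_quads (hyp_span t).
  by apply/hyp_quadsP; split=> //; split; rewrite inE /hyp_proj /= !sE !zE.
have sA : symp_sub (hyp_span t).
  apply/symp_subP; split.
  - by rewrite inE /hyp_proj !sigmav0 !zE.
  - by move=> x y; rewrite !inE hyp_projD => /eqP-> /eqP->.
  move=> x xA x0; have /hyp_quadsP[[eA fA e'A f'A] _ _] := tA.
  have /existsP[y /andP[yA xy]] : [exists y, (y \in hyp_span t) && (sigma x y != 0)].
    apply: contraR x0; rewrite negb_exists => /forallP h.
    have x_perp y : y \in hyp_span t -> sigma y x = 0.
      by move=> yA; apply/eqP; move: (h y); rewrite yA /= negbK sigmaC.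
    move: xA; rewrite inE /hyp_proj /= !x_perp // !zE eq_sym; exact.
  by exists y.
split=> //; move: (tA); rewrite inE => /andP[t1 t2].
have [sB cB] := perp2_symp_sub sA t1; have [sC cC] := perp2_symp_sub sB t2.
suff C1 : perp (perp (perp (perp (hyp_span t) e) f) e') f' = [set 0].
  by rewrite cB cC C1 cards1.
apply/setP=> x; rewrite !inE; apply/idP/eqP => [|->]; last first.
  by rewrite !sigmav0 /hyp_proj !sigmav0 !zE !eqxx.
case/andP=> /andP[/andP[/andP[/eqP xE /eqP ex] /eqP fx] /eqP e'x] /eqP f'x.
by rewrite -xE /hyp_proj /= ex fx e'x f'x !zE.
Qed.

(** * Counting nondegenerate subspaces of dimension 4 *)

Definition symp_sub16 := [set A | symp_sub A && (#|A| == 16%N)].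

(** Quadruples are sorted by their span; the fibre over [A] consists of the quadruples inside
    [A]. *)
Lemma card_symp_sub16 : (#|symp_sub16| * 720)%N = #|hyp_quads setT|.
Proof.
rewrite -[RHS]sum1_card.
rewrite (partition_big (hyp_span) (mem symp_sub16)) => [|t tT]; last first.
  by have [sA cA _] := hyp_span_symp_sub tT; rewrite !inE sA cA.
rewrite -sum_nat_const; apply: eq_bigr => A; rewrite inE => /andP[sA /eqP cA].
(* The value 720 is the count of quadruples for 16 = 8 * 2, that is, at [k = 2]. *)
rewrite sum1dep_card -[LHS]/((8 * 2 - 1) * (4 * 2) * ((2 * 2 - 1) * 2))%N.
rewrite -(card_hyp_quads sA) //; apply: eq_card => t; rewrite [RHS]inE.
apply/idP/andP => [tA | [tT /eqP<-]]; last by case: (hyp_span_symp_sub tT).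
rewrite eq_sym (hyp_span_uniq sA cA tA) eqxx; split=> //.
move: tA; case: t => [[e f] [e' f']] /hyp_quadsP[_ ? ?].
by apply/hyp_quadsP; rewrite !inE.
Qed.

(** * Linear spans and totally isotropic lines *)

Lemma addv_eql x y : (x + y == x) = (y == 0).
Proof. by rewrite -[X in _ == X]addr0 (inj_eq (addrI x)). Qed.

Lemma addv_eqr x y : (x + y == y) = (x == 0).
Proof. by rewrite addrC addv_eql. Qed.

Lemma card_span P : #|[set x | x \in <<enum P>>%VS]| = (2 ^ \dim <<enum P>>)%N.
Proof. by rewrite cardsE card_vspace card_Fp. Qed.

Lemma span_closed A : 0 \in A -> {in A &, forall x y, x + y \in A} ->
  [set x | x \in <<enum (A :\ 0%R)>>%VS] = A.
Proof.
move=> A0 AD; apply/setP=> x; rewrite inE; apply/idP/idP => [|xA].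
  move/(@coord_span _ _ _ (in_tuple _)) => ->.
  apply: (big_ind (fun y => y \in A)) => // i _.
  (* A coefficient is 0 or 1, so every term of the linear combination already lies in [A]. *)
  have [-> | /F2_neq0->] := eqVneq (coord (in_tuple (enum (A :\ 0))) i x) 0.
    by rewrite scale0r.
  have := mem_nth 0 (ltn_ord i); rewrite mem_enum inE scale1r.
  by case/andP.
have [-> | x0] := eqVneq x 0; first exact: mem0v.
by rewrite memv_span // mem_enum !inE x0.
Qed.

Lemma W_linesP (l : {set symp_space N}) :
  reflect (exists a b, [/\ a != 0, b != 0, a != b, sigma a b = 0 &
    l = [set a; b; a + b]]) (l \in W_lines N).
Proof.
apply: (iffP imsetP) => [[[a b]] | [a [b [a0 b0 ab sab ->]]]].
  by rewrite !inE /= => /and4P[a0 b0 ab /eqP sab] ->; exists a, b.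
by exists (a, b); rewrite // !inE /= a0 b0 ab sab eqxx.
Qed.

(** Any two distinct points of a line generate it: the sum of two of [u], [v], [u + v] is the
    third. *)
Lemma W_line_through l a b : l \in W_lines N -> a \in l -> b \in l -> a != b ->
  [/\ sigma a b = 0, l = [set a; b; a + b] & a + b != 0].
Proof.
case/W_linesP=> u [v [u0 v0 uv suv ->]] al bl ab.
rewrite addv_eq0 ab; have svu : sigma v u = 0 by rewrite sigmaC.
have vuv : v + (u + v) = u by rewrite addrC addvK.
have uuv : u + (u + v) = v by rewrite addrA addvv add0r.
have uvv : u + v + v = u by rewrite addvK.
have uvu : u + v + u = v by rewrite addrC uuv.
have vu : v + u = u + v by rewrite addrC.
have sE := (sigmaDl, sigmaDr, sigmavv, suv, svu, addr0).
by move: al bl ab; rewrite !inE => /orP[/orP[]|] /eqP-> /orP[/orP[]|] /eqP->;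
  rewrite ?eqxx // ?sE => _; split=> //;
  apply/setP=> x; rewrite !inE ?(vuv, uuv, uvv, uvu, vu);
  case: (x == u); case: (x == v); case: (x == u + v).
Qed.

Lemma card_W_line l : l \in W_lines N -> #|l| = 3%N.
Proof.
case/W_linesP=> u [v [u0 v0 uv suv ->]].
rewrite setUC cardsU1 cards2 uv !inE negb_or.
by rewrite addv_eql addv_eqr u0 v0.
Qed.

Definition ti_lines P := [set l in W_lines N | l \subset P].

Lemma ti_line_through P a b : a + b \in P -> a \in P -> b \in P -> a != 0 ->
  b != 0 -> a != b -> sigma a b = 0 -> [set a; b; a + b] \in ti_lines P.
Proof.
move=> abP aP bP a0 b0 ab sab; rewrite inE; apply/andP; split.
  by apply/W_linesP; exists a, b.
by apply/subsetP=> x; rewrite !inE => /orP[/orP[]|] /eqP->.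
Qed.

(** With 0 added, the 15 points fill their span of 16 vectors. The lines are forced: orthogonal
    points of [P] are collinear in the doily, and two points determine their line. *)
Lemma linear_doily_symp P L : is_doily P L -> is_linear P ->
  [/\ 0 \notin P, 0 |: P \in symp_sub16 & L = ti_lines P].
Proof.
case/and4P=> /subsetP PW /subsetP LW GQ /forall_inP coll /eqP dimP.
case/and5P: GQ => /eqP cP _ /forall_inP lP /forall_inP aL _.
have P0 : 0 \notin P by apply/negP=> /PW; rewrite inE eqxx.
have sab a b : a \in P -> b \in P -> a != b -> (sigma a b == 0) = collinear L a b.
  by move=> aP bP ab; move/forall_inP: (coll _ aP) => /(_ _ bP)/implyP/(_ ab)/eqP.
have AE : 0 |: P = [set x | x \in <<enum P>>%VS].
  apply/eqP; rewrite eqEcard card_span dimP cardsU1 P0 cP andbT.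
  apply/subsetP=> x; rewrite !inE => /orP[/eqP-> | xP]; first exact: mem0v.
  by rewrite memv_span // mem_enum.
have LP l a b : l \in L -> a \in l -> b \in l -> a != b -> l = [set a; b; a + b].
  by move=> lL al bl ab; have [] := W_line_through (LW _ lL) al bl ab.
split=> //.
  rewrite inE cardsU1 P0 cP eqxx andbT; apply/symp_subP; split.
  - by rewrite !inE eqxx.
  - by move=> x y; rewrite AE !inE; apply: memvD.
  move=> x; rewrite in_setU1 => /orP[/eqP-> | xP]; first by rewrite eqxx.
  move=> x0.
  have /existsP[y /andP[yP xy]] : [exists y, (y \in P) && (sigma x y != 0)].
    apply: contraT; rewrite negb_exists => /forallP h.
    have x_perp y : y \in P -> sigma x y == 0.
      by move=> yP; move: (h y); rewrite yP /= negbK.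
    pose Lx := [set l in L | x \in l].
    (* If [x] were orthogonal to all of [P], the three lines through [x] would cover the 15 points,
       yet they hold at most 3 * 3 = 9. *)
    have : P \subset \bigcup_(l in Lx) l.
      apply/subsetP=> y yP; apply/bigcupP.
      have [<- | xy] := eqVneq x y.
        have /card_gt0P[l lLx] : (0 < #|Lx|)%N by rewrite (eqP (aL _ xP)).
        by exists l => //; move: lLx; rewrite inE => /andP[].
      move: (x_perp _ yP); rewrite sab // => /exists_inP[l lL /andP[xl yl]].
      by exists l; rewrite // inE lL.
    move/subset_leq_card; rewrite cP leqNgt => /negP[].
    apply: (@leq_ltn_trans (\sum_(l in Lx) 3)%N); last first.
      by rewrite sum_nat_const (eqP (aL _ xP)).
    apply: (big_ind2 (fun (S : {set symp_space N}) n => (#|S| <= n)%N)).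
    - by rewrite cards0.
    - move=> S m S' m' Sm Sm'; apply: leq_trans (leq_add Sm Sm').
      by rewrite cardsU leq_subr.
    - by move=> l; rewrite inE => /andP[/lP/andP[_ /eqP->]].
  by exists y; rewrite // in_setU1 yP orbT.
apply/setP=> l; apply/idP/idP => [lL | ].
  by rewrite inE (LW _ lL); case/andP: (lP _ lL).
rewrite inE => /andP[/W_linesP[a [b [a0 b0 ab sab0 ->]]] /subsetP lsP].
have aP : a \in P by apply: lsP; rewrite !inE eqxx.
have bP : b \in P by apply: lsP; rewrite !inE eqxx orbT.
have /exists_inP[m mL /andP[am bm]] : collinear L a b by rewrite -sab // sab0.
by rewrite -(LP _ _ _ mL am bm ab).
Qed.

(** * The doily carried by a nondegenerate subspace of dimension 4 *)

Section FourDimensional.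
Variable A : {set symp_space N}.
Hypotheses (sA : symp_sub A) (cA : #|A| = 16%N).
Let P := A :\ 0.
Let L := ti_lines P.

Let A0 : 0 \in A. Proof. by case/symp_subP: sA. Qed.
Let AD : {in A &, forall x y, x + y \in A}. Proof. by case/symp_subP: sA. Qed.
Let cP : #|P| = 15%N. Proof. by move: (cardsD1 0 A); rewrite A0 cA => -[]. Qed.

Let LW l : l \in L -> l \in W_lines N.
Proof. by rewrite inE => /andP[]. Qed.

Let LP l x : l \in L -> x \in l -> x \in P.
Proof. by rewrite inE => /andP[_ /subsetP]; apply. Qed.

Let line_in a b : a \in P -> b \in P -> a != b -> sigma a b = 0 ->
  [set a; b; a + b] \in L.
Proof.
move=> aP bP ab sab; move: (aP) (bP); rewrite !in_setD1.
case/andP=> a0 aA /andP[b0 bA].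
by apply: ti_line_through; rewrite // in_setD1 addv_eq0 ab AD.
Qed.

Lemma ti_collinear a b : a \in P -> b \in P -> a != b ->
  collinear L a b = (sigma a b == 0).
Proof.
move=> aP bP ab; apply/exists_inP/eqP => [[l lL /andP[al bl]] | sab].
  by have [] := W_line_through (LW lL) al bl ab.
by exists [set a; b; a + b]; rewrite ?line_in // !inE !eqxx orbT.
Qed.

Let card_perpA a : a \in P -> #|perp A a| = 8%N.
Proof.
rewrite !inE => /andP[a0 aA]; have /symp_subP[_ _ And] := sA.
have [g gA ag] := And _ aA a0.
by apply/double_inj; rewrite -(card_perp AD gA ag).
Qed.

(** The orthogonal of [a] in [A] has 8 vectors; without 0 and [a] there remain 6, which the lines
    through [a] group into pairs [x], [a + x]. *)
Lemma card_ti_lines_point a : a \in P -> #|[set l in L | a \in l]| = 3%N.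
Proof.
move=> aP; have := aP; rewrite !inE => /andP[a0 aA].
have cQ : #|perp A a :\ 0 :\ a| = 6%N.
  have := cardsD1 0 (perp A a); have := cardsD1 a (perp A a :\ 0).
  by rewrite card_perpA // !inE A0 aA sigmav0 sigmavv !eqxx a0 /= => -> [->].
apply/eqP; rewrite -(eqn_pmul2r (isT : 0 < 2)%N) -sum_nat_const -[(3 * 2)%N]cQ.
rewrite -[X in _ == X]sum1_card.
rewrite (partition_big (fun x => [set a; x; a + x])
  (mem [set l in L | a \in l])) => [|x] /=; last first.
  rewrite !in_setD1 => /and3P[xa x0 /perpP[xA ax]].
  apply/setIdP; split; last by rewrite !inE eqxx.
  by apply: line_in => //; [rewrite in_setD1 x0 | rewrite eq_sym].
apply/eqP/eq_bigr => l; rewrite inE => /andP[lL al].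
(* The fibre over [l] is [l] without [a], which has two points. *)
rewrite sum1dep_card; apply/esym/eqP; rewrite -(eqn_add2l 1) -[(1 + 2)%N](card_W_line (LW lL)).
rewrite [X in _ == X](cardsD1 a) al eqn_add2l; apply/eqP/eq_card => x.
rewrite !inE; apply/idP/idP => [/andP[/andP[-> _] /eqP<-] | /andP[xa xl]].
  by rewrite !inE eqxx orbT.
have ax : a != x by rewrite eq_sym.
have [sax lE _] := W_line_through (LW lL) al xl ax.
by have := LP lL xl; rewrite !inE xa sax lE !eqxx => /andP[-> ->].
Qed.

(** Double counting of incident point-line pairs: 15 points with 3 lines each, against 3 points on
    each line. *)
Lemma card_ti_lines : #|L| = 15%N.
Proof.
apply/eqP; rewrite -(eqn_pmul2r (isT : 0 < 3)%N) -[X in _ == (X * _)%N]cP.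
rewrite -!sum_nat_const; apply/eqP/esym.
transitivity (\sum_(a in P) \sum_(l in L | a \in l) 1)%N.
  by apply: eq_bigr => a aP; rewrite sum1dep_card card_ti_lines_point.
rewrite (exchange_big_dep (mem L)) //=; last by move=> a l _ /andP[].
apply: eq_bigr => l lL; rewrite -(card_W_line (LW lL)) -sum1_card.
by apply: eq_bigl => x; rewrite lL /=; apply: andb_idl; apply: LP.
Qed.

Lemma ti_lines_meet l1 l2 : l1 \in L -> l2 \in L -> l1 != l2 ->
  (#|l1 :&: l2| <= 1)%N.
Proof.
move=> l1L l2L; apply: contraR; rewrite -ltnNge => /card_gt1P[a [b [+ + ab]]].
rewrite !inE => /andP[a1 a2] /andP[b1 b2].
have [_ -> _] := W_line_through (LW l1L) a1 b1 ab.
by have [_ -> _] := W_line_through (LW l2L) a2 b2 ab.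
Qed.

(* Otherwise a, u, v would span a totally isotropic subspace of dimension 3. *)
Lemma ti_line_maximal a u v : a \in A -> u \in P -> v \in P -> u != v ->
  sigma u v = 0 -> sigma u a = 0 -> sigma v a = 0 ->
  a \in [set 0; u; v; u + v].
Proof.
move=> aA uP vP uv suv sua sva; have /symp_subP[_ _ And] := sA.
have [[u0 uA] [v0 vA]] : (u != 0 /\ u \in A) /\ (v != 0 /\ v \in A).
  by move: uP vP; rewrite !inE => /andP[-> ->] /andP[-> ->].
(* Some [g] is orthogonal to [u] but not to [v]. Take [g2] not orthogonal to [v] and [g3] not
   orthogonal to [u + v]: one of [g2], [g3], [g2 + g3] works. It shows that [v] halves the
   orthogonal of [u] from 8 to 4. *)
have [g gA /andP[/eqP ug vg]] :
    exists2 g, g \in A & (sigma u g == 0) && (sigma v g != 0).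
  have [g2 g2A vg2] := And _ vA v0.
  have [ug2 | ug2] := eqVneq (sigma u g2) 0.
    by exists g2; rewrite // ug2 eqxx.
  have [|g3 g3A] := And (u + v) (AD uA vA); first by rewrite addv_eq0.
  rewrite sigmaDl F2_add_eq0 => uvg3.
  have [ug3 | ug3] := eqVneq (sigma u g3) 0.
    by exists g3; rewrite // ug3 eqxx; move: uvg3; rewrite ug3 eqxx; case: (sigma v g3 == 0).
  exists (g2 + g3); first exact: AD.
  rewrite !sigmaDr !F2_add_eq0 (negPf ug2) (negPf ug3) (negPf vg2) /=.
  by move: uvg3; rewrite (negPf ug3); case: (sigma v g3 == 0).
have cuv : #|perp (perp A u) v| = 4%N.
  have gAu : g \in perp A u by apply/perpP.
  by apply/double_inj; rewrite -(card_perp (perp_closed AD) gAu vg) card_perpA.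
suff -> : [set 0; u; v; u + v] = perp (perp A u) v by do 2?[apply/perpP; split].
apply/eqP; rewrite eqEcard cuv; apply/andP; split.
  have svu : sigma v u = 0 by rewrite sigmaC.
  apply/subsetP=> x; rewrite !inE => /orP[/orP[/orP[]|]|] /eqP->;
    by rewrite ?A0 ?uA ?vA ?AD // ?sigmaDr ?sigmav0 ?sigmavv ?suv ?svu ?addr0 ?eqxx.
rewrite -!setUA !cardsU1 cards1 !inE !(eq_sym 0) ![_ == u + v]eq_sym.
by rewrite addv_eq0 addv_eql addv_eqr (negPf u0) (negPf v0) (negPf uv).
Qed.

(** A nonzero linear form on a plane over the two-element field vanishes at exactly one of its three
    nonzero vectors; here the form is [sigma a] on the plane of [l]. *)
Lemma ti_lines_GQ a l : a \in P -> l \in L -> a \notin l ->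
  #|[set b in l | collinear L a b]| = 1%N.
Proof.
move=> aP lL al.
have -> : [set b in l | collinear L a b] = [set b in l | sigma a b == 0].
  apply/setP=> b; rewrite !inE; case bl: (b \in l) => //=.
  apply: ti_collinear => //; first exact: LP lL bl.
  by apply: contraNneq al => ->.
have /W_linesP[u [v [u0 v0 uv suv lE]]] := LW lL.
have [ul vl uvl] : [/\ u \in l, v \in l & u + v \in l].
  by rewrite lE !inE !eqxx !orbT.
have aA : a \in A by move: aP; rewrite inE => /andP[].
(* The form is nonzero on [l]: otherwise maximality of [l] would put [a] on it. *)
have neq0 : ~~ ((sigma a u == 0) && (sigma a v == 0)).
  apply: contra al => /andP[/eqP au /eqP av].
  have := ti_line_maximal aA (LP lL ul) (LP lL vl) uv suv.
  rewrite !(sigmaC _ a) => /(_ au av); rewrite lE !inE -!orbA => /orP[/eqP a0|] //.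
  by move: aP; rewrite a0 !inE eqxx.
suff [b bE] : exists b, [set b in l | sigma a b == 0] = [set b] by rewrite bE cards1.
have uvu : u + v != u by rewrite addv_eql.
have uvv : u + v != v by rewrite addv_eqr.
have [au | au] := eqVneq (sigma a u) 0; [exists u | have [av | av] := eqVneq (sigma a v) 0; [exists v | exists (u + v)]].
- move: neq0; rewrite au eqxx /= => av; apply/setP=> x; rewrite lE !inE.
  apply/idP/eqP => [/andP[/orP[/orP[]|] /eqP-> //] | ->].
  + by rewrite (negPf av).
  + by rewrite sigmaDr au add0r (negPf av).
  + by rewrite eqxx au eqxx.
- apply/setP=> x; rewrite lE !inE.
  apply/idP/eqP => [/andP[/orP[/orP[]|] /eqP-> //] | ->].
  + by rewrite (negPf au).
  + by rewrite sigmaDr av addr0 (negPf au).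
  + by rewrite eqxx av eqxx orbT.
- apply/setP=> x; rewrite lE !inE.
  apply/idP/eqP => [/andP[/orP[/orP[]|] /eqP-> //] | ->].
  + by rewrite (negPf au).
  + by rewrite (negPf av).
  + by rewrite eqxx orbT sigmaDr F2_add_eq0 (negPf au) (negPf av).
Qed.

Lemma symp_linear_doily : (P, L) \in linear_doilies N.
Proof.
rewrite inE /=; apply/andP; split; last first.
  (* The dimension is read off from the cardinality 2 ^ 4 = 16 of the span. *)
  by rewrite /is_linear -(eqn_exp2l _ _ (isT : 1 < 2)%N) -card_span span_closed // cA.
apply/and4P; split.
- by apply/subsetP=> x; rewrite !inE => /andP[].
- by apply/subsetP=> l; apply: LW.
- apply/and5P; split; rewrite ?cP ?card_ti_lines //.
  + apply/forall_inP=> l lL; rewrite (card_W_line (LW lL)) eqxx andbT.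
    by apply/subsetP=> x; apply: LP.
  + by apply/forall_inP=> a aP; rewrite card_ti_lines_point.
  + apply/andP; split.
      apply/forall_inP=> l1 l1L; apply/forall_inP=> l2 l2L.
      by apply/implyP; apply: ti_lines_meet.
    apply/forall_inP=> a aP; apply/forall_inP=> l lL; apply/implyP=> al.
    by rewrite ti_lines_GQ.
- apply/forall_inP=> a aP; apply/forall_inP=> b bP; apply/implyP=> ab.
  by rewrite ti_collinear.
Qed.

End FourDimensional.

(** Removing 0 and taking all totally isotropic lines is a bijection from subspaces to doilies;
    adding 0 back inverts it. *)
Lemma card_linear_doilies : #|linear_doilies N| = #|symp_sub16|.
Proof.
have sub16_0 A : A \in symp_sub16 -> 0 \in A.
  by rewrite inE => /andP[/symp_subP[]].
rewrite -(@card_in_imset _ _ (fun A => (A :\ 0, ti_lines (A :\ 0)))); last first.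
  by move=> A B /sub16_0 A0 /sub16_0 B0 [AB _]; rewrite -(setD1K A0) AB setD1K.
apply: eq_card => -[P L]; apply/idP/imsetP => [|[A + [-> ->]]].
  rewrite inE => /andP[dPL lP].
  have [/= P0 AP ->] := linear_doily_symp dPL lP.
  by exists (0 |: P); rewrite /= ?setU1K.
by rewrite inE => /andP[sA /eqP cA]; apply: symp_linear_doily.
Qed.

End Symplectic.

(** * The closed formula *)

(** For [N = n + 2] the space has 2 ^ (2n + 4) = 8 * 2 ^ (2n + 1) vectors, which gives the parameter
    [k]. *)
Lemma card_hyp_quads_setT n :
  #|hyp_quads [set: symp_space n.+2]| =
    ((8 * 2 ^ (2 * n).+1 - 1) * (4 * 2 ^ (2 * n).+1)
     * ((2 * 2 ^ (2 * n).+1 - 1) * 2 ^ (2 * n).+1))%N.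
Proof.
apply: card_hyp_quads; first exact: symp_sub_setT.
rewrite cardsT card_mx card_Fp // mul1n -(expnD 2 3).
by congr expn; lia.
Qed.

(** Integer exponents are traded for natural ones, so that the formula becomes polynomial in a power
    of 2. *)
Lemma expz2_sub (n k i : nat) :
  (2 : rat) ^ (n%:Z - k%:Z + i%:Z) = 2 ^+ n / 2 ^+ k * 2 ^+ i.
Proof. by rewrite !expfzDr // exprnN. Qed.

Lemma expz2_subS (n i : nat) :
  (2 : rat) ^ (n%:Z + 1 - i%:Z) = 2 ^+ n * 2 / 2 ^+ i.
Proof. by rewrite !expfzDr // exprnN expr1z. Qed.

Theorem theorem7 (N : nat) (hN : (2 <= N)%N) :
  #|linear_doilies N|%:R =
    gauss_binom 2 (2 * N) 4
    - gauss_binom 2 N 4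
      * \prod_(1 <= i < 5) ((2 : rat) ^ (N%:Z + 1 - i%:Z) + 1)
    - 7 / 3 * (2 : rat) ^ (2 * N%:Z - 6) * gauss_binom 2 N 3
      * \prod_(1 <= i < 4) ((2 : rat) ^ (N%:Z + 1 - i%:Z) + 1)
  :> rat.
Proof.
case: N hN => [|[|n]] // _.
have := card_symp_sub16 n.+2.
rewrite card_hyp_quads_setT -card_linear_doilies.
move/(congr1 (fun m => m%:R : rat)).
(* Truncated subtraction agrees with that of the rationals because each minuend is positive. *)
rewrite !natrM !natrB; try by rewrite muln_gt0 expn_gt0.
rewrite !natrM !natrX; set D := #|_|%:R => DE.
rewrite /gauss_binom !unlock /=.
rewrite !expz2_sub !expz2_subS.
have -> : (2 : rat) ^ (2 * n.+2%:Z - 6) = 2 ^+ (2 * n.+2) / 2 ^+ 6.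
  by rewrite -[2 * _]/((2 * n.+2)%N%:Z) expfzDr // -exprnN.
have pE : (2 : rat) ^+ (2 * n.+2) = (2 ^+ n) ^+ 2 * 16.
  by rewrite -exprM mulnC (_ : 16 = 2 ^+ 4 :> rat) // -exprD; congr (_ ^+ _); lia.
have kE : (2 : rat) ^+ (2 * n).+1 = (2 ^+ n) ^+ 2 * 2.
  by rewrite exprSr mulnC exprM.
have xE : (2 : rat) ^+ n.+2 = 2 ^+ n * 4 by rewrite !exprSr -mulrA.
(* With 2 ^ n replaced by an arbitrary rational [y], both sides are polynomials in [y] once the
   count is divided by 720. *)
move: DE; rewrite pE kE xE; move: D (2 ^+ n) => D y DE.
have -> : D = D * 720 / 720 by field.
by rewrite DE; field.
Qed.
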